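(* For every $\epsilon>0$ there exists $v_0(\epsilon)$ such that for every integer $v>v_0$ with $v\equiv 1\pmod 3$ there exists a $2-(v,4,1)$ directed design $\mathcal{D}$ with $f(\mathcal{D})\geq \frac{5}{8}-\frac{c}{v}$, where $c=\frac{13}{8}+\epsilon$.
   Context: A $2-(v,4,1)$ directed design is a pair $(V,\mathcal{B})$ with $|V|=v$ and $\mathcal{B}$ a collection of ordered 4-tuples of distinct elements of $V$ (blocks) such that every ordered pair $(x,y)$ of distinct elements of $V$ appears in exactly one block (i.e. $x$ and $y$ both occur in it with $x$ before $y$). A defining set of $\mathcal{D}=(V,\mathcal{B})$ is a subset $S\subseteq\mathcal{B}$ contained in no other $2-(v,4,1)$ directed design on $V$. $f(\mathcal{D})$ denotes the minimum cardinality of a defining set of $\mathcal{D}$ divided by $|\mathcal{B}|$. *)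

(* Defs.v *)
From mathcomp Require Import all_boot all_order all_algebra reals.

Set Implicit Arguments.
Unset Strict Implicit.
Unset Printing Implicit Defensive.

Import GRing.Theory.

Section DirectedDesigns.
Variable V : finType.
Implicit Types (b : 4.-tuple V) (B S : {set 4.-tuple V}) (x y : V).

Definition before b x y : bool :=
  [&& x \in b, y \in b & index x b < index y b].

(* A 2-(#|V|,4,1) directed design on V.  Taking the blocks as a set loses
   nothing: a repeated block would cover its pairs more than once. *)
Definition directed_design B : bool :=
  [forall b in B, uniq b] &&
  [forall x, forall y, (x != y) ==> (#|[set b in B | before b x y]| == 1)].

Definition defining_set B S : bool :=
  (S \subset B) &&
  [forall B' : {set 4.-tuple V},
     (directed_design B' && (S \subset B')) ==> (B' == B)].

Lemma defining_set_refl B : directed_design B -> defining_set B B.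
Proof.
case/andP=> _ covB; rewrite /defining_set subxx /=.
apply/forallP=> B'; apply/implyP=> /andP[/andP[uB' covB'] sBB'].
rewrite eqEsubset sBB' andbT; apply/subsetP=> b bB'.
pose x := tnth b ord0; pose y := tnth b (lift ord0 ord0).
have ub : uniq b by apply: (implyP (forallP uB' b)).
have ltxy : before b x y.
  rewrite /before !mem_tnth /x /y !(tnth_nth x) !index_uniq ?size_tuple //.
have nxy : x != y.
  by apply: contraTneq ltxy => ->; rewrite /before ltnn !andbF.
have /cards1P[d dP] := implyP (forallP (forallP covB x) y) nxy.
have /cards1P[e eP] := implyP (forallP (forallP covB' x) y) nxy.
have /andP[dB dxy] : (d \in B) && before d x y.
  by have := set11 d; rewrite -dP inE.
have : b \in [set b in B' | before b x y] by rewrite inE bB'.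
have : d \in [set b in B' | before b x y] by rewrite inE (subsetP sBB').
by rewrite eP !inE => /eqP <- /eqP ->.
Qed.

(* The starting value B is itself a defining set when B is a design
   (defining_set_refl), so this is a genuine minimum. *)
Definition min_defining_card B : nat :=
  #|[arg min_(S < B | defining_set B S) #|S|]|.

End DirectedDesigns.

Local Open Scope ring_scope.

Definition min_defining_ratio (R : realType) (V : finType)
    (B : {set 4.-tuple V}) : R :=
  (min_defining_card B)%:R / #|B|%:R.

(* Main.v *)
Require Import Defs.
From mathcomp Require Import all_boot all_order all_algebra reals.
From mathcomp Require Import perm ring zify.

Set Implicit Arguments.
Unset Strict Implicit.
Unset Printing Implicit Defensive.

Import Order.TTheory GRing.Theory Num.Theory.

(** If one block contains [x], [y] consecutively and another one [y], [x],
interchanging [x] and [y] in both of them gives a different design.  A defining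
set therefore meets every such "swappable" pair, hence contains at least two of
any three pairwise swappable blocks.  Put weight 3 on the points of a
transversal design TD([k] + 1, [m]) whose last group is truncated to [t] points,
replace its blocks by directed group divisible designs of types [3^k] and
[3^(k+1)], adjoin one point, and fill in the groups by designs on [3m + 1] and
[3t + 1] points: this gives a design on [3(km + t) + 1] points.  With [k] = 4, 5
or 6 this yields designs for all [v = 1 %[mod 3]] by induction.  For [k] = 18
there are ingredients which are disjoint unions of triangles of swappable
blocks, and since only about one eighteenth of the pairs lies inside the groups,
the ratio is asymptotically at least 2/3 * 17/18 > 5/8. *)

(* Base blocks of directed group divisible designs of type 3^k, found by
   computer search.  The number 3i + s stands for the point s of the group i.
   For k = 18 and k = 19, consecutive triples of base blocks are pairwise
   swappable. *)
Definition gdd_base (k : nat) : seq (seq nat) :=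
  match k with
  | 4 =>
   [:: [:: 3; 10; 0; 8]; [:: 3; 9; 6; 1]; [:: 0; 11; 3; 7];
       [:: 6; 0; 10; 4]; [:: 0; 6; 9; 5]; [:: 6; 3; 11; 2]]
  | 5 =>
   [:: [:: 0; 13; 3; 7]; [:: 13; 0; 10; 6]]
  | 6 =>
   [:: [:: 0; 10; 15; 7]; [:: 8; 15; 14; 9]; [:: 0; 9; 5; 8]]
  | 7 =>
   [:: [:: 11; 0; 18; 14]; [:: 0; 4; 9; 16]; [:: 13; 0; 19; 15]]
  | 18 =>
   [:: [:: 0; 4; 51; 20]; [:: 4; 0; 40; 49]; [:: 20; 51; 40; 0];
       [:: 0; 47; 15; 21]; [:: 15; 47; 8; 18]; [:: 8; 47; 0; 31];
       [:: 0; 35; 17; 8]; [:: 17; 35; 24; 14]; [:: 49; 24; 35; 0]]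
  | 19 =>
   [:: [:: 0; 5; 24; 53]; [:: 24; 5; 54; 43]; [:: 54; 5; 0; 9];
       [:: 0; 23; 54; 17]; [:: 54; 23; 36; 10]; [:: 36; 23; 0; 6];
       [:: 0; 35; 36; 50]; [:: 36; 35; 24; 7]; [:: 24; 35; 0; 42]]
  | _ => [::]
  end.

(* Base blocks of directed designs on 3n + 1 points, found by computer search:
   one cycle of length 3n + 1 if n is even, two cycles of length (3n + 1)/2 if n
   is odd. *)
Definition design_base (n : nat) : seq (seq nat) :=
  match n with
  | 1 =>
   [:: [:: 3; 1; 0; 2]]
  | 2 =>
   [:: [:: 0; 5; 2; 1]]
  | 3 =>
   [:: [:: 5; 6; 1; 4]; [:: 4; 5; 9; 7]; [:: 1; 3; 5; 2]]
  | 4 =>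
   [:: [:: 0; 1; 3; 9]; [:: 1; 0; 11; 5]]
  | 5 =>
   [:: [:: 8; 10; 9; 4]; [:: 0; 8; 6; 7]; [:: 5; 8; 12; 1];
       [:: 7; 8; 13; 11]; [:: 5; 0; 10; 2]]
  | 6 =>
   [:: [:: 0; 17; 3; 16]; [:: 0; 10; 2; 14]; [:: 0; 8; 9; 15]]
  | 7 =>
   [:: [:: 15; 11; 21; 5]; [:: 11; 19; 10; 4]; [:: 0; 2; 20; 6];
       [:: 11; 13; 0; 14]; [:: 19; 0; 13; 17]; [:: 0; 8; 9; 19];
       [:: 0; 3; 10; 15]]
  | 8 =>
   [:: [:: 0; 7; 24; 1]; [:: 0; 6; 15; 10]; [:: 0; 11; 23; 14];
       [:: 0; 13; 21; 18]]
  | 9 =>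
   [:: [:: 12; 10; 14; 23]; [:: 14; 11; 20; 7]; [:: 14; 19; 16; 17];
       [:: 0; 7; 1; 21]; [:: 0; 26; 11; 6]; [:: 0; 4; 19; 3];
       [:: 14; 4; 21; 9]; [:: 25; 0; 2; 24]; [:: 14; 22; 18; 0]]
  | 10 =>
   [:: [:: 0; 11; 12; 26]; [:: 0; 4; 10; 23]; [:: 9; 0; 3; 5];
       [:: 0; 29; 28; 18]; [:: 0; 7; 16; 24]]
  | 11 =>
   [:: [:: 7; 17; 29; 3]; [:: 29; 0; 14; 25]; [:: 0; 26; 15; 6];
       [:: 0; 23; 2; 20]; [:: 17; 27; 4; 33]; [:: 0; 5; 4; 21];
       [:: 17; 19; 24; 28]; [:: 17; 32; 16; 18]; [:: 22; 0; 3; 12];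
       [:: 0; 10; 11; 24]; [:: 24; 0; 32; 7]]
  | 12 =>
   [:: [:: 0; 7; 23; 3]; [:: 0; 18; 30; 13]; [:: 0; 29; 6; 28];
       [:: 0; 31; 4; 19]; [:: 0; 5; 2; 26]; [:: 29; 0; 27; 1]]
  | 13 =>
   [:: [:: 0; 4; 31; 1]; [:: 20; 34; 18; 33]; [:: 21; 0; 2; 22];
       [:: 20; 27; 35; 32]; [:: 20; 23; 12; 29]; [:: 0; 34; 25; 10];
       [:: 0; 26; 6; 30]; [:: 4; 20; 7; 36]; [:: 20; 14; 3; 2];
       [:: 0; 14; 12; 5]; [:: 0; 39; 21; 7]; [:: 0; 15; 28; 38];
       [:: 22; 20; 17; 13]]
  | 14 =>
   [:: [:: 0; 26; 22; 20]; [:: 0; 8; 27; 13]; [:: 0; 35; 3; 4];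
       [:: 13; 0; 10; 31]; [:: 0; 34; 33; 15]; [:: 0; 28; 17; 23];
       [:: 0; 14; 7; 16]]
  | 15 =>
   [:: [:: 0; 44; 5; 4]; [:: 23; 11; 40; 14]; [:: 12; 23; 4; 32];
       [:: 22; 23; 16; 13]; [:: 5; 36; 23; 21]; [:: 45; 23; 30; 34];
       [:: 34; 0; 37; 30]; [:: 0; 40; 9; 32]; [:: 0; 10; 12; 8];
       [:: 23; 44; 41; 17]; [:: 0; 36; 38; 18]; [:: 17; 0; 7; 42];
       [:: 0; 33; 39; 11]; [:: 1; 23; 2; 28]; [:: 23; 37; 36; 0]]
  | 16 =>
   [:: [:: 0; 4; 18; 35]; [:: 0; 9; 19; 22]; [:: 0; 39; 41; 28];
       [:: 0; 37; 34; 30]; [:: 42; 0; 8; 33]; [:: 0; 5; 6; 29];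
       [:: 0; 27; 21; 47]; [:: 0; 12; 44; 11]]
  | 17 =>
   [:: [:: 26; 15; 13; 33]; [:: 7; 26; 21; 8]; [:: 26; 44; 2; 28];
       [:: 0; 10; 27; 6]; [:: 35; 0; 5; 40]; [:: 26; 24; 14; 16];
       [:: 51; 49; 0; 17]; [:: 0; 3; 12; 42]; [:: 26; 27; 12; 7];
       [:: 0; 15; 36; 19]; [:: 26; 25; 19; 47]; [:: 0; 25; 37; 50];
       [:: 26; 40; 49; 34]; [:: 36; 26; 32; 51]; [:: 23; 26; 30; 4];
       [:: 0; 23; 8; 31]; [:: 26; 23; 38; 29]]
  | 18 =>
   [:: [:: 0; 16; 38; 25]; [:: 0; 51; 50; 43]; [:: 44; 9; 0; 49];
       [:: 0; 13; 21; 36]; [:: 0; 32; 44; 18]; [:: 0; 19; 1; 3];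
       [:: 0; 26; 53; 33]; [:: 0; 17; 45; 14]; [:: 0; 31; 6; 10]]
  | 19 =>
   [:: [:: 29; 10; 55; 24]; [:: 43; 0; 51; 29]; [:: 5; 8; 29; 35];
       [:: 29; 7; 48; 20]; [:: 50; 0; 39; 48]; [:: 0; 4; 21; 47];
       [:: 35; 46; 29; 2]; [:: 29; 43; 42; 30]; [:: 29; 53; 23; 34];
       [:: 29; 4; 22; 9]; [:: 29; 50; 18; 54]; [:: 41; 2; 0; 34];
       [:: 0; 15; 35; 6]; [:: 0; 46; 9; 37]; [:: 46; 0; 28; 22];
       [:: 0; 19; 42; 44]; [:: 29; 32; 6; 16]; [:: 0; 24; 2; 33];
       [:: 0; 25; 26; 8]]
  | _ => [::]
  end.

(** * Ingredients as lists of numbers, verified by computation *)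

Definition precedes (T : eqType) (b : seq T) (x y : T) : bool :=
  [&& x \in b, y \in b & index x b < index y b].

Definition links (T : Type) (b : seq T) : seq (T * T) := zip b (behead b).

Definition swappable (T : eqType) (a b : seq T) : bool :=
  has (fun p => (p.2, p.1) \in links b) (links a).

(** The shift varies in the outer loop, so the translates of consecutive base blocks stay
    consecutive, as [triangles] requires. *)
Definition develop (f : nat -> nat) (m : nat) (bs : seq (seq nat)) :=
  flatten [seq [seq map (iter s f) b | b <- bs] | s <- iota 0 m].

(** The blocks through [x] are collected once in [Lx], which saves scanning all of [L] for every
    pair during evaluation. *)
Definition covers_once (v : nat) (E : rel nat) (L : seq (seq nat)) : bool :=
  all (fun b => [&& size b == 4, uniq b & all (gtn v) b]) L &&
  all (fun x => let Lx := filter (fun b => x \in b) L in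
         all (fun y => count (fun b => precedes b x y) Lx == E x y) (iota 0 v))
      (iota 0 v).

Fixpoint triangles (T : eqType) (L : seq (seq T)) : bool :=
  if L is [:: a, b, c & L'] then
    [&& swappable a b, swappable b c, swappable a c & triangles L']
  else nilp L.

(** Generator of the cyclic group that develops the base blocks: a cycle on the first [r] groups
    combined with a rotation of order 3 inside every group. In all uses [r] is prime to 3, so its
    order is [3 * r]. *)
Definition gdd_shift (r p : nat) : nat :=
  let i := p %/ 3 in
  3 * (if i < r then i.+1 %% r else i) + (p %% 3).+1 %% 3.

Definition gdd_blocks (k r : nat) :=
  develop (gdd_shift r) (3 * r) (gdd_base k).

Definition cyc_shift (w p : nat) : nat := p %/ w * w + p.+1 %% w.

Definition design_blocks (n : nat) :=
  let w := if odd n then (3 * n).+1./2 else (3 * n).+1 in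
  develop (cyc_shift w) w (design_base n).

Definition distinct_groups (p q : nat) : bool := p %/ 3 != q %/ 3.

Lemma gdd_blocks_cover (k r : nat) :
  (k, r) \in [:: (4, 1); (5, 5); (6, 5); (7, 7); (18, 17); (19, 19)] ->
  covers_once (3 * k) distinct_groups (gdd_blocks k r).
Proof.
(* The finitely many cases become one closed boolean, which [vm_compute] can evaluate. *)
suff: all (fun p : nat * nat =>
      covers_once (3 * p.1) distinct_groups (gdd_blocks p.1 p.2))
    [:: (4, 1); (5, 5); (6, 5); (7, 7); (18, 17); (19, 19)].
  by move/allP => H /H.
by vm_compute.
Qed.

(** Nine base blocks form three triangles, and each of the [3 * r] shifts carries them along.
    Distinctness of the blocks later turns counts in the list into cardinalities. *)
Lemma gdd_blocks_triangles (k r : nat) :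
  (k, r) \in [:: (18, 17); (19, 19)] ->
  [&& uniq (gdd_blocks k r), triangles (gdd_blocks k r)
    & size (gdd_blocks k r) == 3 * (9 * r)].
Proof.
suff: all (fun p : nat * nat => let L := gdd_blocks p.1 p.2 in
    [&& uniq L, triangles L & size L == 3 * (9 * p.2)])
    [:: (18, 17); (19, 19)] by move/allP => H /H.
by vm_compute.
Qed.

Lemma design_blocks_cover (n : nat) :
  n \in iota 1 19 ->
  covers_once (3 * n).+1 (fun x y => x != y) (design_blocks n).
Proof.
suff: all (fun n => covers_once (3 * n).+1 (fun x y => x != y)
    (design_blocks n)) (iota 1 19) by move/allP => H /H.
by vm_compute.
Qed.

(** * Decompositions of relations into blocks, and lower bounds for covers *)

Section Blocks.
Variable V : finType.
Implicit Types (b : 4.-tuple V) (B S : {set 4.-tuple V}).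
Implicit Types E : V -> V -> Prop.

(** Stated for an arbitrary relation [E], so that designs on a subset, group divisible designs and
    the pieces of the composition are all instances that can be transported and glued. *)
Record decomposes E B : Prop := Decomposes {
  decomposes_uniq : forall b, b \in B -> uniq b;
  decomposes_sound : forall b x y, b \in B -> before b x y -> E x y;
  decomposes_cover : forall x y, E x y -> exists2 b, b \in B & before b x y;
  decomposes_once : forall b b' x y,
    b \in B -> b' \in B -> before b x y -> before b' x y -> b = b' }.

Definition design_on (Y : {set V}) B :=
  decomposes (fun x y => [/\ x \in Y, y \in Y & x != y]) B.

(** A vertex cover of the graph that joins swappable blocks; [cover_ge] bounds the size of all such
    covers from below. *)
Definition swap_cover B S :=
  forall a b, a \in B -> b \in B -> swappable a b -> (a \in S) || (b \in S).

Definition cover_ge B N :=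
  forall S, S \subset B -> swap_cover B S -> N <= #|S|.

Lemma decomposes_ext E E' B :
  (forall x y, E x y <-> E' x y) -> decomposes E B -> decomposes E' B.
Proof.
move=> EE' [uB sB cB oB]; split=> // [b x y bB bxy | x y /EE'/cB //].
by apply/EE'; apply: sB bxy.
Qed.

Lemma before_tnth b i j : uniq b -> before b (tnth b i) (tnth b j) = (i < j).
Proof.
move=> ub; have idx (x0 : V) k : index (tnth b k) b = k.
  by rewrite (tnth_nth x0) index_uniq ?size_tuple.
by rewrite /before !mem_tnth !(idx (tnth b i)).
Qed.

Lemma before_irr b x : before b x x = false.
Proof. by rewrite /before ltnn !andbF. Qed.

Lemma before_asym b x y : before b x y -> before b y x = false.
Proof. by rewrite /before => /and3P[-> -> /=]; case: ltngtP. Qed.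

Lemma before_memP b x :
  uniq b -> x \in b -> exists y, before b x y \/ before b y x.
Proof.
move=> ub /tnthP[i ->].
exists (tnth b (if i == ord0 then ord_max else ord0)).
rewrite !before_tnth //; case: eqP => [->|/eqP ni0]; first by left.
by right; rewrite lt0n.
Qed.

Lemma before_exists b : uniq b -> exists x y, before b x y.
Proof.
by move=> ub; exists (tnth b ord0), (tnth b ord_max); rewrite before_tnth.
Qed.

Lemma directed_designP B :
  directed_design B <-> decomposes (fun x y => x != y) B.
Proof.
split.
  case/andP=> /forallP uB /forallP cB.
  have c1 x y : x != y -> exists b, [set b in B | before b x y] = [set b].
    by move=> nxy; apply/cards1P; apply: (implyP (forallP (cB x) y)).
  split=> [b bB | b x y bB | x y /c1[b bP] | b b' x y bB b'B bxy b'xy].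
  - exact: (implyP (uB b)).
  - by apply: contraTneq => ->; rewrite before_irr.
  - have : b \in [set b in B | before b x y] by rewrite bP set11.
    by rewrite inE => /andP[]; exists b.
  - have /c1[d dP] : x != y by apply: contraTneq bxy => ->; rewrite before_irr.
    have : b \in [set d] by rewrite -dP inE bB.
    have : b' \in [set d] by rewrite -dP inE b'B.
    by rewrite !inE => /eqP-> /eqP->.
case=> uB sB cB oB; apply/andP; split; first by apply/forall_inP.
apply/forallP=> x; apply/forallP=> y; apply/implyP=> /cB[b bB bxy].
apply/cards1P; exists b; apply/setP=> d; rewrite !inE.
apply/andP/eqP=> [[dB dxy] | ->] //; exact: oB dxy bxy.
Qed.

(** Each block has six pairs of positions [i < j], and no ordered pair of points arises from two of
    these. The ratio calls for this upper bound on the number of blocks. *)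
Lemma card_design B :
  directed_design B -> 6 * #|B| <= #|V| * #|V|.-1.
Proof.
case/directed_designP=> uB sB cB oB.
pose P := [set ij : 'I_4 * 'I_4 | ij.1 < ij.2].
have cP : #|P| = 6.
  rewrite -sum1dep_card.
  rewrite (eq_bigl (fun ij : 'I_4 * 'I_4 => true && (ij.1 < ij.2))) //.
  rewrite -(pair_big_dep xpredT (fun i j : 'I_4 => i < j) (fun _ _ => 1)) /=.
  by do !rewrite ?big_mkcond /= ?big_ord_recl ?big_ord0.
pose F (u : 4.-tuple V * ('I_4 * 'I_4)) := (tnth u.1 u.2.1, tnth u.1 u.2.2).
have injF : {in setX B P &, injective F}.
  move=> [b [i j]] [b' [i' j']] /=; rewrite !inE /=.
  move=> /andP[bB ij] /andP[b'B ij'].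
  case=> e1 e2; have bb' : b = b'.
    apply: (oB _ _ (tnth b i) (tnth b j)) => //.
      by rewrite before_tnth ?uB.
    by rewrite e1 e2 before_tnth ?uB.
  subst b'; have /tuple_uniqP inj := uB _ bB.
  by rewrite (inj _ _ e1) (inj _ _ e2).
rewrite mulnC -cP -cardsX -(card_in_imset injF).
have -> : #|V| * #|V|.-1 = #|[set xy : V * V | xy.1 != xy.2]|.
  rewrite -sum1dep_card.
  rewrite (eq_bigl (fun xy : V * V => true && (xy.1 != xy.2))) //.
  rewrite -(pair_big_dep xpredT (fun x y => x != y) (fun _ _ => 1)) /=.
  under eq_bigr => x _.
    rewrite sum1_card (eq_card (B := predC1 x)) ?cardC1; last first.
      by move=> y; rewrite !inE eq_sym.
    over.
  by rewrite sum_nat_const.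
apply/subset_leq_card/subsetP=> _ /imsetP[[b [i j]] + ->].
rewrite !inE /= => /andP[bB ij].
by apply: (sB b) => //; rewrite before_tnth ?uB.
Qed.

End Blocks.

(** * Consecutive points, and transport of blocks along maps *)

Lemma links_index (T : eqType) (s : seq T) (x y : T) :
  uniq s -> (x, y) \in links s ->
  [/\ x \in s, y \in s & index y s = (index x s).+1].
Proof.
elim: s => [|a [|c s] IH] // us; rewrite inE => /orP[/eqP[-> ->]|xy].
  move: us; rewrite /= !inE negb_or !eqxx orbT => /andP[/andP[nac _] _].
  by split=> //; rewrite (negPf nac).
have /andP[na us'] := us; have [xs ys e] := IH us' xy.
have idx z : z \in c :: s -> index z [:: a, c & s] = (index z (c :: s)).+1.
  by move=> zs; rewrite [LHS]/= ifN //; apply: contraNneq na => ->.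
have sub z := @mem_behead _ [:: a, c & s] z.
by split; [exact: sub | exact: sub | rewrite !idx ?e].
Qed.

Lemma links_map (T U : Type) (f : T -> U) (s : seq T) :
  links (map f s) = [seq (f p.1, f p.2) | p <- links s].
Proof.
by elim: s => [|x [|y s] IH] //; rewrite /links /= in IH *; congr (_ :: _).
Qed.

Lemma swappable_map (T U : eqType) (f : T -> U) (a b : seq T) :
  swappable a b -> swappable (map f a) (map f b).
Proof.
case/hasP=> p pa pb; apply/hasP; exists (f p.1, f p.2); rewrite links_map.
  by apply/mapP; exists p.
by apply/mapP; exists (p.2, p.1).
Qed.

Lemma swappable_map_inj (T U : eqType) (f : T -> U) (a b : seq T) :
  injective f -> swappable (map f a) (map f b) -> swappable a b.
Proof.
move=> injf; rewrite /swappable !links_map => /hasP[_ /mapP[p pa ->]].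
case/mapP=> q qb [/injf e1 /injf e2]; apply/hasP; exists p => //=.
by rewrite e1 e2 -surjective_pairing.
Qed.

Lemma index_map_in (T U : eqType) (f : T -> U) (s : seq T) (x : T) :
  {in x :: s &, injective f} -> index (f x) (map f s) = index x s.
Proof.
elim: s => //= a s IH injf; congr (if _ then _ else _.+1).
  apply/eqP/eqP=> [|-> //]; apply: injf; rewrite !inE eqxx ?orbT //.
apply: IH; apply: sub_in2 injf => z.
by rewrite !inE => /orP[->|->]; rewrite ?orbT.
Qed.

Lemma before_map_in (U V : finType) (f : U -> V) (b : 4.-tuple U) (x y : U) :
  {in b &, injective f} -> x \in b -> y \in b ->
  before (map_tuple f b) (f x) (f y) = before b x y.
Proof.
move=> injf xb yb.
have sub z : z \in b -> {in z :: b &, injective f}.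
  by move=> zb; apply: sub_in2 injf => w; rewrite inE => /orP[/eqP->|].
rewrite /before xb yb /=; rewrite !index_map_in; try exact: sub.
by rewrite (map_f f xb) (map_f f yb).
Qed.

Lemma before_mapP (U V : finType) (f : U -> V) (b : 4.-tuple U) (u v : V) :
  {in b &, injective f} -> before (map_tuple f b) u v ->
  exists x y, [/\ before b x y, f x = u & f y = v].
Proof.
move=> injf buv; have /and3P[/mapP[x xb eu] /mapP[y yb ev] _] := buv.
by exists x, y; split=> //; rewrite -(before_map_in injf) // -eu -ev.
Qed.

(** * Interchanging two points in a pair of swappable blocks *)

Section Swap.
Variable V : finType.
Implicit Types (b : 4.-tuple V) (B S : {set 4.-tuple V}).

(** As [x] and [y] are adjacent in [b], every other point of [b] precedes both or follows both. The
    interchange therefore affects only the order of [x] and [y] themselves. *)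
Lemma before_tperm b x y z w :
  uniq b -> ((x, y) \in links b) || ((y, x) \in links b) ->
  before (map_tuple (tperm x y) b) z w =
  if ((z == x) && (w == y)) || ((z == y) && (w == x)) then before b w z
  else before b z w.
Proof.
move=> ub; wlog xy : x y / (x, y) \in links b.
  move=> IH /orP[] xy; first by rewrite IH ?xy.
  by rewrite tpermC orbC IH ?xy.
move=> _; have [xb yb e] := links_index ub xy.
have inj : {in b &, injective (tperm x y)} by move=> ? ? _ _; apply: perm_inj.
have neq u : u \in b -> u != y -> index u b != index y b.
  move=> ubb; apply: contraNneq => eu.
  by rewrite -(nth_index u ubb) eu nth_index.
have neq' u : u \in b -> u != x -> index u b != index x b.
  move=> ubb; apply: contraNneq => eu.
  by rewrite -(nth_index u ubb) eu nth_index.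
have mt u : (tperm x y u \in b) = (u \in b).
  by case: tpermP => [->|->|//]; rewrite xb yb.
have -> : before (map_tuple (tperm x y) b) z w =
    before b (tperm x y z) (tperm x y w).
  have mm u : u \in map (tperm x y) b -> tperm x y u \in b.
    by case/mapP=> u' ub' ->; rewrite tpermK.
  case zb: (z \in b); last first.
    rewrite /before (mt z) zb /=; apply/negbTE/negP => /andP[/mm].
    by rewrite mt zb.
  case wb: (w \in b); last first.
    rewrite /before (mt w) wb andbF /=; apply/negbTE/negP => /and3P[_ /mm].
    by rewrite mt wb.
  by rewrite -(before_map_in inj) ?mt // !tpermK.
rewrite /before; case: (tpermP x y z) => [->|->|/eqP zx /eqP zy].
- rewrite eqxx /=; case: (tpermP x y w) => [->|->|/eqP wx /eqP wy].
  + by rewrite xb yb !ltnn !andbF /=; case: ifP.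
  + by rewrite eqxx.
  + rewrite (negPf wy) (negPf wx) andbF /= xb yb /=.
    case wb: (w \in b) => //=; have := neq _ wb wy; have := neq' _ wb wx.
    by rewrite e; lia.
- rewrite eqxx /=; case: (tpermP x y w) => [->|->|/eqP wx /eqP wy].
  + by rewrite eqxx orbT.
  + by rewrite xb yb !ltnn !andbF /=; case: ifP.
  + rewrite (negPf wy) (negPf wx) andbF /= xb yb /=.
    case wb: (w \in b) => //=; have := neq _ wb wy; have := neq' _ wb wx.
    by rewrite e; lia.
- rewrite (negPf zx) (negPf zy) /=; case: (tpermP x y w) => [->|->|_ _] //.
  + case zb: (z \in b) => //=; have := neq _ zb zy; have := neq' _ zb zx.
    by rewrite xb yb e /=; lia.
  + case zb: (z \in b) => //=; have := neq _ zb zy; have := neq' _ zb zx.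
    by rewrite xb yb e /=; lia.
Qed.

(** If [S] missed both blocks, interchanging [x] and [y] in them would give a design that still
    contains [S], hence equals [B]. The modified [b1] would then lie in [B] and share an ordered
    pair with [b1] without being equal to it. *)
Lemma defining_swap_cover B S :
  directed_design B -> defining_set B S -> swap_cover B S.
Proof.
move=> desB /andP[sSB /forallP defS] b1 b2 b1B b2B /hasP[[x y] l1 l2].
apply/negPn/negP; rewrite negb_or => /andP[b1S b2S].
have [uB sB cB oB] := (directed_designP B).1 desB.
have before_links b u v : b \in B -> (u, v) \in links b -> before b u v.
  move=> bB /(links_index (uB _ bB))[ub vb e].
  by rewrite /before ub vb e ltnSn.
have b1xy := before_links _ _ _ b1B l1; have b2yx := before_links _ _ _ b2B l2.
pose phi b := if (b == b1) || (b == b2) then map_tuple (tperm x y) b else b.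
(* The formula is uniform in [b]: a block other than [b1] and [b2] contains neither of the pairs
   [(x, y)] and [(y, x)], so reversing them changes nothing there. *)
have before_phi b z w : b \in B -> before (phi b) z w =
    if ((z == x) && (w == y)) || ((z == y) && (w == x)) then before b w z
    else before b z w.
  move=> bB; rewrite /phi; case: ifP => [eb|/negbT].
    rewrite before_tperm ?uB //.
    by case/orP: eb => /eqP->; rewrite ?l1 ?l2 ?orbT.
  rewrite negb_or => /andP[nb1 nb2].
  have bxy : before b x y = false.
    by apply: contraNF nb1 => bxy; rewrite (oB _ _ _ _ bB b1B bxy b1xy).
  have byx : before b y x = false.
    by apply: contraNF nb2 => byx; rewrite (oB _ _ _ _ bB b2B byx b2yx).
  by case: ifP => // /orP[] /andP[/eqP-> /eqP->]; rewrite bxy byx.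
have uphi b : b \in B -> uniq (phi b).
  rewrite /phi => /uB ub; case: ifP => // _; rewrite map_inj_uniq //.
  exact: perm_inj.
have desB' : directed_design (phi @: B).
  apply/directed_designP; split.
  - by move=> _ /imsetP[b bB ->]; apply: uphi.
  - move=> b' u v _ buv; apply: contraTneq buv => ->.
    by rewrite before_irr.
  - move=> z w zw; case E: (((z == x) && (w == y)) || ((z == y) && (w == x))).
      (* A pair formed by [x] and [y] is now covered by the image of the block that covered its
         reverse. *)
      have [|b bB bwz] := cB w z; first by rewrite eq_sym.
      by exists (phi b); rewrite ?imset_f // before_phi // E.
    have [b bB bzw] := cB z w zw.
    by exists (phi b); rewrite ?imset_f // before_phi // E.
  - move=> _ _ z w /imsetP[b bB ->] /imsetP[d dB ->].
    rewrite !before_phi //; case: ifP => _ pb pd; congr phi; exact: oB pb pd.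
have SB' : S \subset phi @: B.
  apply/subsetP=> b bS; apply/imsetP; exists b; first exact: (subsetP sSB).
  rewrite /phi; case: ifP => // /orP[] /eqP eb.
    by rewrite -eb bS in b1S.
  by rewrite -eb bS in b2S.
have /eqP eB : phi @: B == B by apply: (implyP (defS _)); rewrite desB' SB'.
have phib1 : phi b1 \in B by rewrite -eB imset_f.
have b1yx : before (phi b1) y x by rewrite before_phi // !eqxx orbT.
(* A third point [z] of [b1] takes part in a pair that the interchange does not affect; that pair
   forces [phi b1] to be [b1]. *)
have [z zb zxy] : exists2 z, z \in b1 & z \notin [:: x; y].
  apply/allPn/negP => /allP sub.
  by have := uniq_leq_size (uB _ b1B) sub; rewrite size_tuple.
have e1 : phi b1 = b1.
  have [w [bzw|bwz]] := before_memP (uB _ b1B) zb.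
    apply: (oB _ _ z w) => //; rewrite before_phi //.
    by move: zxy; rewrite !inE negb_or => /andP[/negPf-> /negPf->].
  apply: (oB _ _ w z) => //; rewrite before_phi //.
  move: zxy; rewrite !inE negb_or => /andP[/negPf-> /negPf->].
  by rewrite !andbF.
by rewrite e1 (before_asym b1xy) in b1yx.
Qed.

(** The upper bound will serve to show that [B] is nonempty. *)
Lemma min_defining_card_ge B N :
  directed_design B -> cover_ge B N -> N <= min_defining_card B <= #|B|.
Proof.
move=> desB geN; have defB := defining_set_refl desB.
rewrite /min_defining_card; case: arg_minnP => // S defS minS.
have sSB : S \subset B by case/andP: defS.
rewrite (subset_leq_card sSB) andbT; apply: geN => //.
exact: defining_swap_cover.
Qed.

End Swap.

(** * Images of decompositions under maps injective on the points involved *)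

Section Image.
Variables (U V : finType) (f : U -> V) (X : {set U}).
Variables (E : U -> U -> Prop) (B : {set 4.-tuple U}).
Hypothesis injf : {in X &, injective f}.
Hypothesis EX : forall x y, E x y -> x \in X /\ y \in X.
Hypothesis decB : decomposes E B.

Lemma decomposes_points b x : b \in B -> x \in b -> x \in X.
Proof.
case: decB => uB sB _ _ bB /before_memP[|y [bxy|byx]]; first exact: uB.
  by have /EX[] := sB _ _ _ bB bxy.
by have /EX[] := sB _ _ _ bB byx.
Qed.

Lemma decomposes_inj_in b : b \in B -> {in b &, injective f}.
Proof.
by move=> bB x y xb yb; apply: injf; apply: decomposes_points bB _.
Qed.

Lemma map_block_once b d u v : b \in B -> d \in B ->
  before (map_tuple f b) u v -> before (map_tuple f d) u v -> b = d.
Proof.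
case: decB => uB sB _ oB bB dB.
case/(before_mapP (decomposes_inj_in bB))=> x [y [bxy <- <-]].
case/(before_mapP (decomposes_inj_in dB))=> x' [y' [dxy ex ey]].
have [xX yX] := EX (sB _ _ _ bB bxy); have [x'X y'X] := EX (sB _ _ _ dB dxy).
by rewrite (injf x'X xX ex) (injf y'X yX ey) in dxy; apply: oB dxy.
Qed.

Lemma map_block_inj :
  {in B &, injective (map_tuple f : 4.-tuple U -> 4.-tuple V)}.
Proof.
move=> b d bB dB ebd; case: (decB) => uB _ _ _.
have [u [v buv]] : exists u v, before (map_tuple f b) u v.
  apply: before_exists; rewrite map_inj_in_uniq ?uB //.
  exact: decomposes_inj_in.
by apply: (map_block_once bB dB buv); rewrite -ebd.
Qed.

Lemma decomposes_image :
  decomposes (fun u v => exists x y, [/\ E x y, f x = u & f y = v])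
    (map_tuple f @: B).
Proof.
case: (decB) => uB sB cB oB; split.
- move=> _ /imsetP[b bB ->]; rewrite map_inj_in_uniq ?uB //.
  exact: decomposes_inj_in.
- move=> _ u v /imsetP[b bB ->] /(before_mapP (decomposes_inj_in bB)).
  by case=> x [y [bxy <- <-]]; exists x, y; split=> //; apply: sB bxy.
- move=> _ _ [x [y [/cB[b bB bxy] <- <-]]]; exists (map_tuple f b).
    exact: imset_f.
  have /and3P[xb yb _] := bxy.
  by rewrite before_map_in //; apply: decomposes_inj_in.
- move=> _ _ u v /imsetP[b bB ->] /imsetP[d dB ->] bu du.
  by rewrite (map_block_once bB dB bu du).
Qed.

(** A cover of the image pulls back to a cover of [B], since maps preserve swappability, and the
    pullback is no larger because distinct blocks have distinct images. *)
Lemma cover_ge_image N :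
  cover_ge B N -> cover_ge (map_tuple f @: B : {set 4.-tuple V}) N.
Proof.
move=> geN S sSB covS; pose S0 := [set b in B | map_tuple f b \in S].
have sS0 : S0 \subset B by apply/subsetP=> b; rewrite inE => /andP[].
apply: (leq_trans (geN S0 sS0 _)).
  move=> a b aB bB /(swappable_map f) ab; rewrite !inE aB bB /=.
  by apply: covS ab; apply: imset_f.
rewrite -(card_in_imset (sub_in2 (subsetP sS0) map_block_inj)).
by apply/subset_leq_card/subsetP => _ /imsetP[b + ->]; rewrite inE => /andP[].
Qed.

End Image.

(** * Gluing decompositions of disjoint relations *)

Section Union.
Variables (V I : finType) (E : I -> V -> V -> Prop) (B : I -> {set 4.-tuple V}).
Hypothesis decB : forall i, decomposes (E i) (B i).
Hypothesis disjE : forall i j x y, E i x y -> E j x y -> i = j.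

Lemma block_index_uniq i j b : b \in B i -> b \in B j -> i = j.
Proof.
move=> bi bj; have [uB sBi _ _] := decB i; have [_ sBj _ _] := decB j.
have [x [y bxy]] := before_exists (uB _ bi).
exact: disjE (sBi _ _ _ bi bxy) (sBj _ _ _ bj bxy).
Qed.

Lemma decomposes_bigcup :
  decomposes (fun x y => exists i, E i x y) (\bigcup_i B i).
Proof.
split.
- by move=> b /bigcupP[i _ bB]; have [uB _ _ _] := decB i; apply: uB.
- move=> b x y /bigcupP[i _ bB] bxy; exists i.
  by have [_ sB _ _] := decB i; apply: sB bxy.
- move=> x y [i Exy]; have [_ _ cB _] := decB i; have [b bB bxy] := cB _ _ Exy.
  by exists b => //; apply/bigcupP; exists i.
- move=> b d x y /bigcupP[i _ bB] /bigcupP[j _ dB] bxy dxy.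
  have [_ sBi _ oB] := decB i; have [_ sBj _ _] := decB j.
  have eij := disjE (sBi _ _ _ bB bxy) (sBj _ _ _ dB dxy).
  by subst j; apply: oB bxy dxy.
Qed.

(** A cover of the union restricts to a cover of each piece, and the pieces share no block, so the
    lower bounds add up. *)
Lemma cover_ge_bigcup (N : I -> nat) :
  (forall i, cover_ge (B i) (N i)) -> cover_ge (\bigcup_i B i) (\sum_i N i).
Proof.
move=> geN S sSB covS.
apply: (@leq_trans (\sum_i #|S :&: B i|)).
  apply: leq_sum => i _; apply: geN; first exact: subsetIr.
  move=> a b aB bB ab; rewrite !inE aB bB !andbT.
  by apply: covS ab; apply/bigcupP; exists i.
(* Double counting: after the exchange of sums, each block of [S] is counted at most once, by
   [block_index_uniq]. *)
under eq_bigr => i _ do rewrite -sum1_card big_mkcond.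
rewrite exchange_big -[X in _ <= X]sum1_card [X in _ <= X]big_mkcond.
apply: leq_sum => b _; rewrite -big_mkcond.
case bS: (b \in S); last first.
  by rewrite big_pred0 // => i; rewrite inE bS.
rewrite sum1_card; apply/card_le1_eqP => i j /setIP[_ ib] /setIP[_ jb].
by apply: block_index_uniq jb ib.
Qed.

End Union.

(** * Covers of lists of triangles, and the passage from lists to sets of tuples *)

Lemma triangles_count (T : eqType) (L : seq (seq T)) (Q : pred (seq T)) :
  triangles L ->
  (forall a b, a \in L -> b \in L -> swappable a b -> Q a || Q b) ->
  2 * size L <= 3 * count Q L.
Proof.
(* Strong induction on the length, because three blocks are removed at a time. *)
have [n] := ubnP (size L); elim: n L => // n IH [|a [|b [|c L]]] //= ltn.
case/and4P=> ab bc ac triL cov.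
have {}IH : 2 * size L <= 3 * count Q L.
  apply: IH => //; first by lia.
  by move=> u v uL vL; apply: cov; rewrite !inE ?uL ?vL !orbT.
have ia : a \in [:: a, b, c & L] by rewrite !inE eqxx.
have ib : b \in [:: a, b, c & L] by rewrite !inE eqxx orbT.
have ic : c \in [:: a, b, c & L] by rewrite !inE eqxx !orbT.
have := cov a b ia ib ab; have := cov b c ib ic bc; have := cov a c ia ic ac.
by case: (Q a); case: (Q b); case: (Q c) => //= _ _ _; lia.
Qed.

Section FromLists.
Variables (v : nat) (E : rel nat) (L : seq (seq nat)).
Hypothesis okL : covers_once v E L.

Definition block_set : {set 4.-tuple 'I_v} :=
  [set b : 4.-tuple 'I_v | map val b \in L].

Lemma count_precedes (x y : 'I_v) :
  count (fun b : seq nat => precedes b x y) L = E x y.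
Proof.
have /andP[_ /allP cov] := okL.
have iv (z : 'I_v) : val z \in iota 0 v by rewrite mem_iota ltn_ord.
have /allP/(_ _ (iv y))/eqP <- := cov _ (iv x).
rewrite count_filter; apply: eq_count => b; rewrite /= /precedes.
by case: (nat_of_ord x \in b); rewrite ?andbT ?andbF.
Qed.

Lemma precedes_val (b : 4.-tuple 'I_v) x y :
  precedes (map val b) (val x) (val y) = before b x y.
Proof. by rewrite /precedes !(mem_map val_inj) !(index_map val_inj). Qed.

Lemma list_block l : l \in L -> exists b : 4.-tuple 'I_v, map val b = l.
Proof.
move=> lL; have /andP[/allP/(_ _ lL)/and3P[/eqP sl _ /allP ltl] _] := okL.
(* All entries are below [v], so [insub] loses none of them. *)
have sv : size (pmap (insub : nat -> option 'I_v) l) = 4.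
  rewrite size_pmap_sub; apply/eqP.
  by rewrite -sl -all_count; apply/allP.
exists (tcast sv (in_tuple (pmap insub l))).
rewrite val_tcast /= (pmap_filter (insubK _)).
by apply/all_filterP/allP => i /ltl iv; rewrite insubT.
Qed.

Lemma block_set_decomposes : decomposes (fun x y : 'I_v => E x y) block_set.
Proof.
have /andP[/allP wf _] := okL; split.
- move=> b; rewrite inE => /wf/and3P[_ + _]; by rewrite (map_inj_uniq val_inj).
- move=> b x y; rewrite inE -precedes_val => bL bxy.
  have : 0 < count (fun b : seq nat => precedes b x y) L.
    by rewrite -has_count; apply/hasP; exists (map val b).
  by rewrite count_precedes; case: (E x y).
- move=> x y Exy; have : 0 < count (fun b : seq nat => precedes b x y) L.
    by rewrite count_precedes Exy.
  rewrite -has_count => /hasP[l lL]; have [b eb] := list_block lL.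
  by rewrite -eb precedes_val => bxy; exists b => //; rewrite inE eb.
- move=> b b' x y; rewrite !inE -!precedes_val => bL b'L bxy b'xy.
  apply/val_inj/(inj_map val_inj).
  have := count_precedes x y; rewrite -size_filter => szE.
  have : map val b \in filter (fun b : seq nat => precedes b x y) L.
    by rewrite mem_filter bxy.
  have : map val b' \in filter (fun b : seq nat => precedes b x y) L.
    by rewrite mem_filter b'xy.
  case: filter szE => [|l [|l' s]] //=; last by case: (E x y).
  by rewrite !inE => _ /eqP-> /eqP->.
Qed.

Lemma block_set_cover_ge :
  uniq L -> triangles L -> cover_ge block_set (2 * (size L %/ 3)).
Proof.
move=> uL triL S sSB covS.
(* [triangles_count] speaks of lists of numbers, so [S] is viewed there through the values of its
   ordinals. *)
pose Q := [pred l | l \in [seq map val (b : 4.-tuple 'I_v) | b <- enum S]].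
have QS (b : 4.-tuple 'I_v) : Q (map val b) = (b \in S).
  apply/mapP/idP => [[b' + e]|bS]; last by exists b; rewrite ?mem_enum.
  rewrite mem_enum => b'S.
  by have -> : b = b' by apply/val_inj/(inj_map val_inj).
have cov l l' : l \in L -> l' \in L -> swappable l l' -> Q l || Q l'.
  move=> lL l'L; have [b eb] := list_block lL; have [b' eb'] := list_block l'L.
  have [bB b'B] : b \in block_set /\ b' \in block_set by rewrite !inE eb eb'.
  rewrite -eb -eb' => /(swappable_map_inj val_inj) bb'.
  by rewrite !QS; apply: covS bb'.
have := triangles_count triL cov.
have : count Q L <= #|S|.
  rewrite -size_filter cardE -(size_map (fun b : 4.-tuple 'I_v => map val b)).
  apply: uniq_leq_size => [|l]; first exact: filter_uniq.
  by rewrite mem_filter => /andP[].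
by move: (count Q L) #|S| (size L) => c s z; lia.
Qed.

End FromLists.

(** * Existence statements for the ingredients *)

(** Quantifying over all point sets of the right size allows a design to be placed on any group
    together with the adjoined point. *)
Definition has_design n N :=
  forall (U : finType) (Y : {set U}), #|Y| = (3 * n).+1 ->
  exists B, design_on Y B /\ cover_ge B N.

Definition has_gdd k N :=
  exists B : {set 4.-tuple 'I_(3 * k)},
    decomposes (fun x y : 'I_(3 * k) => distinct_groups x y) B /\ cover_ge B N.

(** One point set suffices: matching the enumerations of [X] and [Y] gives a bijection along which
    the design is transported. *)
Lemma has_designP (U : finType) (X : {set U}) B n N :
  #|X| = (3 * n).+1 -> design_on X B -> cover_ge B N -> has_design n N.
Proof.
move=> cX desB geN V Y cY.
have cXY : #|X| = #|Y| by rewrite cX.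
have [y0 y0Y] : exists y, y \in Y by apply/card_gt0P; rewrite cY.
pose f x := nth y0 (enum Y) (index x (enum X)).
have lt x : x \in X -> index x (enum X) < size (enum Y).
  by move=> xX; rewrite -cardE -cXY cardE index_mem mem_enum.
have injf : {in X &, injective f}.
  move=> x y xX yX /eqP; rewrite nth_uniq ?lt ?enum_uniq // => /eqP e.
  rewrite -(nth_index x (s := enum X) (x := x)) ?mem_enum //.
  by rewrite e nth_index ?mem_enum.
have EX x y : [/\ x \in X, y \in X & x != y] -> x \in X /\ y \in X by case.
exists (map_tuple f @: B); split; last exact: cover_ge_image injf EX desB N geN.
apply: decomposes_ext (decomposes_image injf EX desB) => u v.
split=> [[x [y [[xX yX xy] <- <-]]]|[uY vY uv]].
  have fY z : z \in X -> f z \in Y by move=> /lt zX; rewrite -mem_enum mem_nth.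
  by rewrite !fY //; split=> //; apply: contraNneq xy => /injf->.
have pre z : z \in Y -> exists2 x, x \in X & f x = z.
  rewrite -mem_enum => zY; have ltz : index z (enum Y) < size (enum X).
    by rewrite -cardE cXY cardE index_mem.
  have [x0 _] : exists x, x \in X by apply/card_gt0P; rewrite cX.
  exists (nth x0 (enum X) (index z (enum Y))).
    by rewrite -mem_enum mem_nth.
  by rewrite /f index_uniq ?enum_uniq // nth_index.
have [x xX ex] := pre u uY; have [y yX ey] := pre v vY.
exists x, y; split=> //; split=> //.
by apply: contraNneq uv => xy; rewrite -ex -ey xy.
Qed.

(** This fills an empty truncated group, where only the adjoined point remains. *)
Lemma has_design0 : has_design 0 0.
Proof.
move=> U Y cY; exists set0; split=> //.
split=> [b|b x y|x y|b b' x y]; rewrite ?inE //.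
case=> xY yY; have /card_le1_eqP eqY : #|Y| <= 1 by rewrite cY.
by rewrite (eqY _ _ xY yY) eqxx.
Qed.

Lemma has_gdd_small k r :
  (k, r) \in [:: (4, 1); (5, 5); (6, 5); (7, 7)] -> has_gdd k 0.
Proof.
move=> kr; have okL : covers_once (3 * k) distinct_groups (gdd_blocks k r).
  apply: gdd_blocks_cover; move: kr.
  by rewrite !inE => /or4P[] ->; rewrite ?orbT.
exists (block_set (3 * k) (gdd_blocks k r)); split=> //.
exact: block_set_decomposes okL.
Qed.

Lemma has_gdd_triangles k r :
  (k, r) \in [:: (18, 17); (19, 19)] -> has_gdd k (18 * r).
Proof.
move=> kr; have okL : covers_once (3 * k) distinct_groups (gdd_blocks k r).
  apply: gdd_blocks_cover; move: kr.
  by rewrite !inE => /orP[] ->; rewrite ?orbT.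
have /and3P[uL triL /eqP sz] := gdd_blocks_triangles kr.
exists (block_set (3 * k) (gdd_blocks k r)); split.
  exact: block_set_decomposes okL.
have -> : 18 * r = 2 * (size (gdd_blocks k r) %/ 3) by rewrite sz mulKn //; lia.
exact: block_set_cover_ge okL uL triL.
Qed.

Lemma has_design_small n : n < 20 -> has_design n 0.
Proof.
case: n => [|n] ltn; first exact: has_design0.
have okL : covers_once (3 * n.+1).+1 (fun x y => x != y) (design_blocks n.+1).
  by apply: design_blocks_cover; rewrite mem_iota.
pose B := block_set (3 * n.+1).+1 (design_blocks n.+1).
apply: (@has_designP _ setT B) => //.
  by rewrite cardsT card_ord.
apply: decomposes_ext (block_set_decomposes okL) => x y.
by rewrite !inE; split=> [|[]].
Qed.

(** * Composition over a truncated transversal design *)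

Section Composition.
Variables (k m t N0 N1 : nat).
Hypotheses (m_gt1 : 1 < m) (le_tm : t <= m).
Hypothesis m_coprime : forall d, 0 < d < k -> coprime m d.

Local Notation A := 'Z_m.
(** [None] is the adjoined point; the component in ['I_3] realises the weight 3. *)
Local Notation pt := (option (('I_k.+1 * A) * 'I_3)).

(* The lines of TD(k + 1, m), a line being given by intercept and slope; it
   meets the last group in its slope. *)
Definition column (i : 'I_k.+1) (p : A * A) : A :=
  if i < k then (p.1 + i%:R * p.2)%R else p.2.

Definition group (i : 'I_k.+1) : {set A} :=
  if i < k then setT else [set a : A | a < t].

Definition group_points (i : 'I_k.+1) : {set pt} :=
  [set u | if u is Some w then (w.1.1 == i) && (w.1.2 \in group i) else true].

Definition points : {set pt} :=
  [set u | if u is Some w then w.1.2 \in group w.1.1 else true].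

Definition line_rel (p : A * A) (x y : pt) : Prop :=
  exists i j s s', [/\ i != j, column i p \in group i, column j p \in group j,
    x = Some (i, column i p, s) & y = Some (j, column j p, s')].

Definition group_rel (i : 'I_k.+1) (x y : pt) : Prop :=
  [/\ x \in group_points i, y \in group_points i & x != y].

Lemma card_Zm : #|A| = m.
Proof. by rewrite card_ord Zp_cast. Qed.

Lemma card_group i : #|group i| = if i < k then m else t.
Proof.
rewrite /group; case: ifP => _; first by rewrite cardsT card_Zm.
have le_tz : t <= (Zp_trunc m).+2 by rewrite Zp_cast.
rewrite -sum1dep_card (@big_ord_narrow nat 0 addn _ _ (fun=> 1) le_tz).
by rewrite sum1_card card_ord.
Qed.

Lemma sub_unit i j : i < j < k -> ((j%:R - i%:R : A) \is a GRing.unit)%R.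
Proof.
case/andP=> ij jk; rewrite -natrB ?(ltnW ij) // unitZpE //.
apply: m_coprime; rewrite subn_gt0 ij.
by apply: leq_ltn_trans jk; apply: leq_subr.
Qed.

(** Two points in different groups determine their line: within the first [k] groups the slope is
    obtained by dividing by [j - i], a unit by [m_coprime], and the last group displays the slope
    directly. *)
Lemma column_inj i j p q : i != j ->
  column i p = column i q -> column j p = column j q -> p = q.
Proof.
wlog ij : i j / i < j.
  move=> IH nij ei ej; case: (ltngtP i j) => [ij|ij|eij].
  - exact: IH ij nij ei ej.
  - by apply: IH ij _ ej ei; rewrite eq_sym.
  - by rewrite (val_inj eij) eqxx in nij.
move=> _; have ik : i < k by apply: leq_trans ij _; rewrite -ltnS.
case: p q => [a b] [c d]; rewrite /column ik /=; case: ifP => [jk|_] e1 e2.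
  have ebd : b = d.
    have ijk : i < j < k by rewrite ij.
    have inj := GRing.mulrI (sub_unit ijk); apply: inj.
    have -> : ((j%:R - i%:R) * b = (a + j%:R * b) - (a + i%:R * b) :> A)%R.
      by ring.
    by rewrite e1 e2; ring.
  by rewrite ebd in e1 *; move/addIr: e1 => ->.
by rewrite e2 in e1 *; move/addIr: e1 => ->.
Qed.

Lemma column_surj i j a b : i != j ->
  exists p, column i p = a /\ column j p = b.
Proof.
wlog ij : i j a b / i < j.
  move=> IH nij; case: (ltngtP i j) => [ij|ij|eij].
  - exact: IH ij nij.
  - by have [|p []] := IH j i b a ij; [rewrite eq_sym | exists p].
  - by rewrite (val_inj eij) eqxx in nij.
move=> _; have ik : i < k by apply: leq_trans ij _; rewrite -ltnS.
rewrite /column ik; case jk: (j < k); last first.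
  by exists (a - i%:R * b, b)%R; rewrite /= subrK.
(* The slope of the line through the two given points. *)
pose y := ((j%:R - i%:R)^-1 * (b - a))%R : A.
exists (a - i%:R * y, y)%R; rewrite /= subrK; split=> //.
have e : ((j%:R - i%:R) * y = b - a)%R by rewrite mulVKr // sub_unit ?ij.
have -> : (a - i%:R * y + j%:R * y = a + (j%:R - i%:R) * y)%R by ring.
by rewrite e; ring.
Qed.

Lemma points_cover x y : [/\ x \in points, y \in points & x != y] <->
  (exists p, line_rel p x y) \/ (exists i, group_rel i x y).
Proof.
split.
  case: x y => [[[i a] s]|] [[[j b] s']|] []; rewrite ?inE //= => ai bj xy.
  - have [eij|nij] := eqVneq i j.
      by subst j; right; exists i; split; rewrite // inE /= eqxx.
    have [p [ea eb]] := column_surj a b nij.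
    by left; exists p, i, j, s, s'; rewrite ea eb.
  - by right; exists i; split; rewrite ?inE //= ai eqxx.
  - by right; exists j; split; rewrite ?inE //= bj eqxx.
case=> [[p [i [j [s [s' [nij ai bj -> ->]]]]]]|[i [xi yi xy]]].
  rewrite !inE ai bj; split=> //; apply: contraNneq nij.
  by case=> -> _ _.
have sub u : u \in group_points i -> u \in points.
  by rewrite !inE; case: u => [[[i' a] s]|//] /= /andP[/eqP-> ->].
by split=> //; apply: sub.
Qed.

Definition piece_rel (c : (A * A) + 'I_k.+1) : pt -> pt -> Prop :=
  match c with inl p => line_rel p | inr i => group_rel i end.

(** The adjoined point lies in every filled group, but of two distinct points at least one is not
    adjoined, and that one determines the group. *)
Lemma piece_rel_disjoint c d x y : piece_rel c x y -> piece_rel d x y -> c = d.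
Proof.
have lg p i : line_rel p x y -> group_rel i x y -> False.
  case=> [j [j' [s [s' [nj _ _ -> ->]]]]] []; rewrite !inE /=.
  by move=> /andP[/eqP ej _] /andP[/eqP ej' _]; rewrite ej ej' eqxx in nj.
case: c d => [p|i] [q|j] /=.
- case=> [i [j [s [s' [nij _ _ -> ->]]]]] [i' [j' [r [r' [_ _ _]]]]].
  by case=> <- ei _ [<- ej _]; rewrite (column_inj nij ei ej).
- by move=> lp /(lg _ _ lp).
- by move=> gi /lg/(_ gi).
- case=> xi yi xy [xj yj _]; congr inr; move: xi yi xj yj xy; rewrite !inE.
  clear lg; case: x => [[[a b] s]|] /=.
    by move=> /andP[/eqP-> _] _ /andP[/eqP-> _].
  by case: y => [[[a b] s]|//] /= _ /andP[/eqP-> _] _ /andP[/eqP-> _].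
Qed.

(** The line meets exactly the first [h] groups; group [i] of the ingredient is placed on the three
    copies of its point in [group i]. *)
Lemma line_piece p h N : h <= k.+1 ->
  (forall i, (column i p \in group i) = (i < h)) -> has_gdd h N ->
  exists B : {set 4.-tuple pt}, decomposes (line_rel p) B /\ cover_ge B N.
Proof.
move=> le_hk colh [B [decB geN]].
(* The default value of [inord] never occurs, as [q %/ 3 < h <= k.+1]. *)
pose f (q : 'I_(3 * h)) : pt :=
  let i := inord (q %/ 3) in Some (i, column i p, inord (q %% 3)).
have ltq (q : 'I_(3 * h)) : q %/ 3 < h by have := ltn_ord q; lia.
have lt3 (q : 'I_(3 * h)) : q %/ 3 < k.+1 by apply: leq_trans (ltq q) le_hk.
have injf : {in setT &, injective f}.
  move=> q q' _ _ [] /(congr1 val) /= + _ /(congr1 val) /=.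
  rewrite !inordK ?ltn_mod // => e1 e2; apply: val_inj => /=.
  by rewrite (divn_eq q 3) e1 e2 -divn_eq.
have ET (x y : 'I_(3 * h)) :
    distinct_groups x y -> x \in [set: 'I_(3 * h)] /\ y \in [set: 'I_(3 * h)].
  by rewrite !inE.
exists (map_tuple f @: B); split; last exact: cover_ge_image injf ET decB N geN.
apply: decomposes_ext (decomposes_image injf ET decB) => u v.
split=> [[x [y [xy <- <-]]]|].
  exists (inord (x %/ 3)), (inord (y %/ 3)), (inord (x %% 3)), (inord (y %% 3)).
  by rewrite !colh !inordK //; split=> //; rewrite -val_eqE /= !inordK.
case=> [i [j [s [s' [nij + + -> ->]]]]]; rewrite !colh => ih jh.
have pre (a : 'I_k.+1) (r : 'I_3) : a < h ->
    exists2 q : 'I_(3 * h), q %/ 3 = a & f q = Some (a, column a p, r).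
  move=> ah; have ltar : 3 * a + r < 3 * h by have := ltn_ord r; lia.
  have e1 : (3 * a + r) %/ 3 = a by have := ltn_ord r; lia.
  have e2 : (3 * a + r) %% 3 = r by have := ltn_ord r; lia.
  exists (Ordinal ltar) => //; rewrite /f /= e2 e1.
  by rewrite !inord_val.
have [x ex fx] := pre i s ih; have [y ey fy] := pre j s' jh.
by exists x, y; split=> //; rewrite /distinct_groups ex ey.
Qed.

Lemma card_option_prod (T : finType) (W : {set T}) :
  #|[set u : option (T * 'I_3) | if u is Some w then w.1 \in W else true]|
  = (3 * #|W|).+1.
Proof.
have -> : [set u : option (T * 'I_3) | if u is Some w then w.1 \in W else true]
  = None |: Some @: setX W setT.
  apply/setP=> -[[w s]|]; rewrite !inE /=; last by [].
  by rewrite mem_imset ?inE ?andbT // => ? ? [].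
rewrite cardsU1 card_imset => [|? ? [] //].
rewrite cardsX cardsT card_ord mulnC.
suff -> : (None \in Some @: setX W [set: 'I_3]) = false by [].
by apply/negbTE/imsetP => -[].
Qed.

Lemma card_points : #|points| = (3 * (k * m + t)).+1.
Proof.
have := card_option_prod [set w : 'I_k.+1 * A | w.2 \in group w.1].
have -> : #|[set w : 'I_k.+1 * A | w.2 \in group w.1]| = k * m + t.
  rewrite -sum1dep_card.
  rewrite (eq_bigl (fun w : 'I_k.+1 * A => true && (w.2 \in group w.1))) //.
  rewrite -(pair_big_dep xpredT (fun i a => a \in group i) (fun _ _ => 1)) /=.
  under eq_bigr => i _ do rewrite sum1_card card_group.
  rewrite big_ord_recr /= ltnn; congr (_ + _).
  under eq_bigr => i _ do rewrite /= ltn_ord.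
  by rewrite sum_nat_const card_ord.
by move=> <-; apply: eq_card => -[[[i a] s]|]; rewrite !inE.
Qed.

Lemma card_group_points i :
  #|group_points i| = (3 * (if i < k then m else t)).+1.
Proof.
rewrite -card_group; have := card_option_prod (setX [set i] (group i)).
rewrite cardsX cards1 mul1n => <-.
by apply: eq_card => -[[[j a] s]|]; rewrite !inE.
Qed.

(** Each slope belongs to [m] lines. A line loses its point in the last group exactly when its slope
    is at least [t], so [t] slopes use the larger ingredient and [m - t] the smaller one. The filled
    groups contribute 0 to the bound. *)
Lemma has_design_composition :
  has_gdd k N0 -> has_gdd k.+1 N1 -> has_design m 0 -> has_design t 0 ->
  has_design (k * m + t) (m * (t * N1 + (m - t) * N0)).
Proof.
move=> gdd0 gdd1 desm dest.
pose N (c : (A * A) + 'I_k.+1) :=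
  if c is inl p then if p.2 < t then N1 else N0 else 0.
have pieces c : exists B, decomposes (piece_rel c) B /\ cover_ge B (N c).
  case: c => [p|i] /=; last first.
    have [B [desB _]] : exists B, design_on (group_points i) B /\ cover_ge B 0.
      have des : has_design (if i < k then m else t) 0 by case: ifP.
      by apply: des; apply: card_group_points.
    by exists B.
  have inT i : (column i p \in group i) = (i < k) || (p.2 < t).
    by rewrite /column /group; case: ifP => _; rewrite inE.
  case: ifP => pt.
    by apply: (@line_piece _ k.+1) => // i; rewrite inT pt orbT ltn_ord.
  by apply: (@line_piece _ k) => // i; rewrite inT pt orbF.
have [B BP] := fin_all_exists pieces.
have decB c : decomposes (piece_rel c) (B c) by case: (BP c).
have geB c : cover_ge (B c) (N c) by case: (BP c).
have desB : design_on points (\bigcup_c B c).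
  apply: decomposes_ext (decomposes_bigcup decB piece_rel_disjoint) => x y.
  rewrite points_cover; split=> [[[p|i] c]|[[p c]|[i c]]].
  - by left; exists p.
  - by right; exists i.
  - by exists (inl p).
  - by exists (inr i).
suff eN : \sum_c N c = m * (t * N1 + (m - t) * N0).
  apply: has_designP card_points desB _.
  by rewrite -eN; exact: (cover_ge_bigcup decB piece_rel_disjoint geB).
rewrite big_sumType /= [X in _ + X]big1 // addn0.
rewrite -(pair_big xpredT xpredT
  (fun _ (b : A) => if b < t then N1 else N0)) /=.
rewrite sum_nat_const card_Zm; congr (_ * _).
have cT : #|[set b : A | b < t]| = t.
  by have := card_group ord_max; rewrite /group /= ltnn.
rewrite (bigID (fun b : A => b < t)) /=; congr (_ + _).
  rewrite (eq_bigr (fun=> N1)) => [|b ->] //.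
  by rewrite sum_nat_const -[in RHS]cT cardsE.
rewrite (eq_bigr (fun=> N0)) => [|b /negPf->] //.
rewrite sum_nat_const; congr (_ * _).
have := cardC [set b : A | b < t]; rewrite cT card_Zm => /(congr1 (subn^~ t)).
by rewrite addKn => <-; apply: eq_card => b; rewrite !inE.
Qed.

End Composition.

(** * Designs on [3 * n + 1] points for every [n] *)

Lemma has_design_step k m t :
  1 < m -> t <= m -> (forall d, 0 < d < k -> coprime m d) ->
  has_gdd k 0 -> has_gdd k.+1 0 -> has_design m 0 -> has_design t 0 ->
  has_design (k * m + t) 0.
Proof.
move=> m1 tm cop g0 g1 dm dt.
by have := has_design_composition m1 tm cop g0 g1 dm dt; rewrite !muln0.
Qed.

Lemma coprime6 m d : coprime m 6 -> 0 < d < 5 -> coprime m d.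
Proof.
rewrite (coprimeMr m 2 3) => /andP[m2 m3].
case: d => [|[|[|[|[|d]]]]] // _; first exact: coprimen1.
by rewrite (coprimeMr m 2 2) m2.
Qed.

Lemma exists_coprime6 n : 20 <= n -> n != 43 ->
  exists m, [/\ coprime m 6, 1 < m & 4 * m <= n <= 6 * m].
Proof.
move=> n20 n43.
have cop m : (m %% 6 == 1) || (m %% 6 == 5) -> coprime m 6.
  by rewrite -coprime_modl => /orP[] /eqP->.
case: (leqP n 30) => [n30|n30]; first by exists 5; split=> //; lia.
case: (leqP n 42) => [n42|n42]; first by exists 7; split=> //; lia.
(* The list gives the distance from [n %/ 4] down to the nearest number that is 1 or 5 modulo 6. *)
exists (n %/ 4 - nth 0 [:: 1; 0; 1; 2; 3; 0] ((n %/ 4) %% 6)).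
have : (n %/ 4) %% 6 < 6 by rewrite ltn_mod.
case E: ((n %/ 4) %% 6) => [|[|[|[|[|[|//]]]]]] _ /=;
  by split; try (apply: cop); lia.
Qed.

Lemma has_design_all n : has_design n 0.
Proof.
have [N] := ubnP n; elim: N n => // N IH n ltn.
case: (ltnP n 20) => [|n20]; first exact: has_design_small.
have gdd k : k \in [:: 4; 5; 6; 7] -> has_gdd k 0.
  by rewrite !inE => /or4P[] /eqP->;
    [apply: (@has_gdd_small 4 1) | apply: (@has_gdd_small 5 5)
    | apply: (@has_gdd_small 6 5) | apply: (@has_gdd_small 7 7)].
(* For [m] = 7 the interval from [4 * m] to [6 * m] ends at 42, and for the next value 11 it starts
   at 44. The gap is filled by 43 = 6 * 7 + 1. *)
have [n43|n43] := eqVneq n 43.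
  rewrite n43; apply: (@has_design_step 6 7 1) => //; try exact: gdd.
  - by case=> [|[|[|[|[|[|d]]]]]].
  - by apply: IH; lia.
  - by apply: IH; lia.
have [m [m6 m1 /andP[le4 le6]]] := exists_coprime6 n20 n43.
have desm : has_design m 0 by apply: IH; lia.
(* The choice between [k] = 4 and [k] = 5 keeps the truncated group no larger than [m]. *)
case: (leqP n (5 * m)) => le5.
  have -> : n = 4 * m + (n - 4 * m) by lia.
  apply: has_design_step => //; try exact: gdd; first by lia.
  - by move=> d /andP[d0 d4]; apply: coprime6 => //; lia.
  - by apply: IH; lia.
have -> : n = 5 * m + (n - 5 * m) by lia.
apply: has_design_step => //; try exact: gdd; first by lia.
- by move=> d d5; apply: coprime6.
- by apply: IH; lia.
Qed.

(** * Designs with a large lower bound for covers *)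

Lemma exists_scale M : 0 < M -> exists n0, forall n, n0 < n ->
  exists m, [/\ coprime m M, 18 <= m & 18 * m <= n <= 19 * m].
Proof.
move=> M0; exists (18 * (19 * M + 19)) => n ltn.
pose a := n %/ 18; pose q := a.-1 %/ M.
have ea := divn_eq a.-1 M; have lta := ltn_pmod a.-1 M0.
have [an na] : 18 * a <= n /\ n < 18 * a + 18 by rewrite /a; lia.
(* This is the largest number at most [a] that is 1 modulo [M]. It falls short of [a] by less than
   [M], which the choice of [n0] makes small enough for [n <= 19 * m]. *)
exists (q * M + 1); split.
- by rewrite -coprime_modl modnMDl coprime_modl coprime1n.
- by rewrite -/q in ea; lia.
- by rewrite -/q in ea; lia.
Qed.

(** The constants are the bounds of the two ingredients: 306 = 18 * 17 for [k] = 18 and 342 = 18 *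
    19 for [k] = 19. *)
Lemma has_design_dense : exists n0, forall n, n0 < n ->
  exists m, [/\ 18 <= m, 18 * m <= n <= 19 * m &
    has_design n (m * ((n - 18 * m) * 342 + (m - (n - 18 * m)) * 306))].
Proof.
(* A number prime to the factorial of 17 is prime to every [d] with [0 < d < 18], as the transversal
   design requires. *)
have [n0 n0P] := exists_scale (fact_gt0 17).
exists n0 => n /n0P[m [cop m18 /andP[le18 le19]]]; exists m.
have en : n = 18 * m + (n - 18 * m) by rewrite subnKC.
split; rewrite ?le18 //; rewrite {1}en.
apply: has_design_composition; rewrite ?leq_subLR //; first by lia.
- by rewrite -mulSnr.
- move=> d /andP[d0 d18]; apply: coprime_dvdr cop.
  by apply: dvdn_fact; rewrite d0.
- exact: (@has_gdd_triangles 18 17).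
- exact: (@has_gdd_triangles 19 19).
- exact: has_design_all.
- exact: has_design_all.
Qed.

(** * The bound on the ratio *)

Local Open Scope ring_scope.

Theorem theorem3p5 (R : realType) (eps : R) (heps : 0 < eps) :
  exists v0 : nat, forall v : nat, (v0 < v)%N -> (v = 1 %[mod 3])%N ->
    exists (V : finType) (B : {set 4.-tuple V}),
      [/\ #|V| = v, directed_design B
        & 5 / 8 - (13 / 8 + eps) / v%:R <= min_defining_ratio R B].
Proof.
have [n0 n0P] := has_design_dense; exists (3 * n0 + 3)%N => v ltv v1.
pose n := (v %/ 3)%N; have ev : v = (3 * n).+1 by rewrite /n; lia.
have [|m [m18 /andP[le18 le19] des]] := n0P n; first by rewrite /n; lia.
have [|B [desB geB]] := des 'I_v setT; first by rewrite cardsT card_ord.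
have dirB : directed_design B.
  apply/directed_designP; apply: decomposes_ext desB => x y.
  by rewrite !inE; split=> [[]|].
exists 'I_v, B; split=> //; first exact: card_ord.
have /andP[geN leB] := min_defining_card_ge dirB geB.
have := card_design dirB; rewrite card_ord => le6.
pose t := (n - 18 * m)%N; have en : n = (18 * m + t)%N by rewrite /t; lia.
rewrite -/t in geN; have le_tm : (t <= m)%N by rewrite /t; lia.
(* Here 6 #|B| is at most 3n(3n + 1), and the minimum is at least 306m^2 + 36mt. With n = 18m + t
   the claim reduces to 36m^2 + 36mt >= 15t^2 + 90m + 5t, which follows from [t <= m] and
   [18 <= m]. *)
have le58 : (5 * #|B| <= 8 * min_defining_card B)%N.
  by nia.
have B_gt0 : (0 < #|B|)%N by nia.
(* The ratio is at least 5/8 itself, and the term subtracted in the statement is nonnegative. *)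
apply: (@le_trans _ _ (5 / 8)).
  by rewrite gerBl divr_ge0 // addr_ge0 ?divr_ge0 ?ler0n // ltW.
rewrite /min_defining_ratio ler_pdivlMr ?ltr0n // mulrAC ler_pdivrMr ?ltr0n //.
by rewrite -!natrM ler_nat [leqRHS]mulnC.
Qed.
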